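(* There exists a constant $\delta_0>0$ depending only on $\gamma$ such that the following holds. Given any equilibrium $(\rho_\dagger,R_\dagger)=(\rho_\dagger[M,V],R_\dagger[M,V])$ with gas mass $M>0$ and liquid volume $V>0$, let $(\rho(r,t),R(t),\overline R(t)=(R(t)^3+\overline V)^{1/3})$ be any mass-preserving (i.e. $\int_{B_{R(t)}}\rho(|x|,t)\,dx=M$) and volume-invariant spherically symmetric state such that $$\Big\|\frac{\rho(\cdot,t)-\rho_\dagger}{\rho_\dagger}\big(1+|\log\rho_\dagger|\big)\Big\|_{L^\infty(B_{R(t)})}\le\delta_0 .$$ Then $$\begin{aligned}E(t)\ge E_\dagger+\frac14\Big\{&M\mathfrak{c}T_c\Big(\frac{\bar\rho(1,t)-\rho_\dagger}{\rho_\dagger}-\frac{3}{4\pi\rho_\dagger}\int_{B_1}(\bar\rho(y,t)-\rho_\dagger)\,dy\Big)^2\\&+\frac{\rho_lR_\dagger^5}{4\pi\rho_\dagger^2}\Big(1-\frac{R_\dagger}{\overline R_\dagger}\Big)\Big(\int_{B_1}\partial_t\bar\rho(y,t)\,dy\Big)^2+\frac{\mathfrak{R}T_cR_\dagger^3}{3\rho_\dagger}\int_{B_1}|\bar\rho(y,t)-\rho_\dagger|^2dy\\&+\frac{R_\dagger^3}{\pi\rho_\dagger^2}\Big[\frac{\sigma}{2R_\dagger}+\frac{\bar\sigma}{\overline R_\dagger}\Big(1-\frac{R_\dagger^3}{2\overline R_\dagger^3}\Big)\Big]\Big(\int_{B_1}(\bar\rho(y,t)-\rho_\dagger)\,dy\Big)^2\Big\},\end{aligned}$$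 where $E(t)=E[\bar\rho(\cdot,t),R(t)]$ with $\bar\rho(y,t)=\rho(R(t)|y|,t)$, $E_\dagger=E[\rho_\dagger,R_\dagger]$, and $t>0$ is arbitrary. Moreover, $(\rho(r,t),R(t))$ is not required to be a solution of the evolution problem.
   Context: Constants: $\rho_l,\mathfrak{c},\mathfrak{R},T_c,\sigma,\bar\sigma>0$ (liquid density, gas specific heat, gas constant, external temperature, inner and outer surface tension coefficients), $\gamma=1+\mathfrak{R}/\mathfrak{c}$. $\overline V=3V/(4\pi)$. $(\rho_\dagger[M,V],R_\dagger[M,V])$ is the unique pair of positive numbers with $\frac{4\pi}3\rho_\dagger R_\dagger^3=M$ and $\rho_\dagger=\frac{2}{\mathfrak{R}T_c}\big(\frac{\sigma}{R_\dagger}+\frac{\bar\sigma}{\overline R_\dagger}\big)$, $\overline R_\dagger=(R_\dagger^3+\overline V)^{1/3}$. $B_a\subset\mathbb R^3$ is the ball of radius $a$ centered at $0$. Energy functional of a spherically symmetric state (gas in $B_{R(t)}$ with radial density $\rho$; liquid in $B_{\overline R(t)}\setminus\overline{B_{R(t)}}$ with velocity $R^2\dot R\,x/|x|^3$; spatially constant gas pressure $p_g=\mathfrak{R}T_c\rho(R(t),t)$). It equals the sum of the Helmholtz free energy $\mathfrak{c}\int\rho T_g\,dx-T_c\int\rho s\,dx$ (with $p_g=\mathfrak{R}T_g\rho$, $s=\mathfrak{c}\log(p_g/\rho^\gamma)$), the liquid kinetic energy, and the surface energies $4\pi\sigma R^2+4\pi\bar\sigma\overline R^2$; explicitly $$\begin{aligned}E[\bar\rho(\cdot,t),R(t)]={}&\tfrac{4\pi\mathfrak{c}T_c}{3}\bar\rho(1,t)R^3-\mathfrak{c}T_cM\log(\mathfrak{R}T_c)-\mathfrak{c}T_cM\log\bar\rho(1,t)+\mathfrak{c}\gamma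 T_cR^3\int_{B_1}\bar\rho\log\bar\rho\,dy\\&+2\pi\rho_lR^3\dot R^2-2\pi\rho_l\frac{R^4\dot R^2}{\overline R}+4\pi(\sigma R^2+\bar\sigma\overline R^2).\end{aligned}$$ $E[\rho_\dagger,R_\dagger]$ is its value at the constant-in-time state $\bar\rho\equiv\rho_\dagger$, $R\equiv R_\dagger$. *)

(* Defs.v *)
From HB Require Import structures.
From mathcomp Require Import all_boot all_order all_algebra.
From mathcomp Require Import all_classical all_reals all_analysis.

Set Implicit Arguments.
Unset Strict Implicit.
Unset Printing Implicit Defensive.

Import Order.TTheory GRing.Theory Num.Theory.
Import numFieldNormedType.Exports.

Local Open Scope classical_set_scope.
Local Open Scope ring_scope.

Section Euclidean3.
Context {R : realType}.

(* Points of R^3 are triples; the norm that MathComp-Analysis puts on a product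
   is the sup norm, hence the explicit Euclidean norm. *)
Definition enorm (x : R * R * R) : R :=
  Num.sqrt (x.1.1 ^+ 2 + x.1.2 ^+ 2 + x.2 ^+ 2).

Definition eball (a : R) : set (R * R * R) := [set x | enorm x < a].

Definition leb3 :=
  ((@lebesgue_measure R \x @lebesgue_measure R) \x @lebesgue_measure R)%E.

Definition intB (a : R) (f : R * R * R -> R) : R :=
  \int[leb3]_(x in eball a) f x.

Definition LinftyB (a : R) (f : R * R * R -> R) : \bar R :=
  'N[leb3]_+oo [EFin \o (f \_ (eball a))].

End Euclidean3.

Record constants (R : realType) := Constants {
  rhol : R;   (* liquid density *)
  cg : R;     (* gas specific heat *)
  Rg : R;     (* gas constant *)
  Tc : R;     (* external temperature *)
  sig : R;    (* inner surface tension coefficient *)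
  sigo : R;   (* outer surface tension coefficient *)
  rhol_gt0 : 0 < rhol;
  cg_gt0 : 0 < cg;
  Rg_gt0 : 0 < Rg;
  Tc_gt0 : 0 < Tc;
  sig_gt0 : 0 < sig;
  sigo_gt0 : 0 < sigo
}.

Section Bubble.
Context {R : realType}.
Variable k : constants R.

Definition gam : R := 1 + Rg k / cg k.

Definition outer (V a : R) : R := (a ^+ 3 + 3 * V / (4 * pi)) `^ (3^-1).

Definition equilibrium (M V rhod Rd : R) : Prop :=
  [/\ 0 < rhod, 0 < Rd,
      4 * pi / 3 * rhod * Rd ^+ 3 = M &
      rhod = 2 / (Rg k * Tc k) * (sig k / Rd + sigo k / outer V Rd)].

(* A state is given by the radial gas density rho r t, for 0 <= r <= a t, and
   by the bubble radius a t, for t > 0; the values of rho and a elsewhere are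
   irrelevant. *)
Implicit Types (rho : R -> R -> R) (a : R -> R).

(* The density pulled back to the unit ball, as a function of s = |y|. *)
Definition rhobar rho a (s t : R) : R := rho (a t * s) t.

Definition dt_rhobar rho a (s t : R) : R := derive1 (rhobar rho a s) t.

(* Classical regularity, as needed for the traces rhobar 1 t and for the time
   derivatives in the energy estimate to make sense.  No evolution equation is
   imposed. *)
Definition state rho a : Prop :=
  [/\ forall t, 0 < t -> 0 < a t,
      forall t, 0 < t -> derivable a t 1,
      forall t, 0 < t -> {within `[0, 1], continuous (rhobar rho a ^~ t)},
      forall s t, 0 <= s <= 1 -> 0 < t -> derivable (rhobar rho a s) t 1 &
      {within [set z : R * R | 0 <= z.1 <= 1 /\ 0 < z.2],
        continuous (fun z => dt_rhobar rho a z.1 z.2)}].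

Definition mass_preserving (M : R) rho a : Prop :=
  forall t, 0 < t -> intB (a t) (fun x => rho (enorm x) t) = M.

(* E[rb(.,t), a(t)]; volume invariance is built in through [outer V]. *)
Definition energy (M V : R) (rb : R -> R -> R) a (t : R) : R :=
  4 * pi * cg k * Tc k / 3 * rb 1 t * a t ^+ 3
  - cg k * Tc k * M * ln (Rg k * Tc k)
  - cg k * Tc k * M * ln (rb 1 t)
  + cg k * gam * Tc k * a t ^+ 3
    * intB 1 (fun y => rb (enorm y) t * ln (rb (enorm y) t))
  + 2 * pi * rhol k * a t ^+ 3 * derive1 a t ^+ 2
  - 2 * pi * rhol k * (a t ^+ 4 * derive1 a t ^+ 2 / outer V (a t))
  + 4 * pi * (sig k * a t ^+ 2 + sigo k * outer V (a t) ^+ 2).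

End Bubble.

(* Main.v *)
Require Import Defs.
From HB Require Import structures.
From mathcomp Require Import all_boot all_order all_algebra.
From mathcomp Require Import all_classical all_reals all_analysis.
From mathcomp Require Import measurable_realfun ess_sup_inf.
From mathcomp Require Import lebesgue_integral_under ring lra.
Import Order.TTheory GRing.Theory Num.Theory.
Import numFieldNormedType.Exports.
Local Open Scope classical_set_scope.
Local Open Scope ring_scope.

(** Why the bound holds.  Let [P] be the mean over the unit ball of the
    rescaled density [u = rhobar(., t)], and write [P = rhod (1 + m)].  Mass
    conservation says [a(t)^3 P = Rd^3 rhod = 3 M / (4 pi)], so [m] and the
    radius determine each other: [(a / Rd)^3 = 1 / (1 + m)].  With this
    substitution the excess energy is exactly a sum of four terms
    ([energy_excess]):

    - interface: [M c T (r - 1 - ln r)] with [r = u(1) / P];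
    - bulk entropy: [(c + G) T a^3 (int u ln u - (4 pi / 3) P ln P)];
    - capillary: [G T M ln (1 + m)] plus the variation of the two surface
      energies;
    - kinetic: [2 pi rhol a^3 a'^2 (1 - a / A)],

    where [A] is the outer radius, [c], [G], [T] are the specific heat, the gas
    constant and the temperature.  The first two are at least quadratic because
    [r - 1 - ln r] and [u ln u] are strictly convex, and the linear term of
    [u ln u] at the mean [P] integrates to zero.  In the capillary term the
    pressure balance at equilibrium cancels the part linear in [m]; the
    quadratic part is half of a positive second derivative, while the
    right-hand side of the theorem asks for a quarter of the same second
    derivative.  In the kinetic term the derivative of the mass constraint
    expresses [int dt u] through the wall speed [a'], and the two sides differ
    by the factor [1/2] and by powers of [a / Rd].  So every term has at
    least a factor two to spare, which pays for the cubic remainders as soon as the relative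
    deviation of the density is at most [1/100].

    The quadratic bounds are [ln1D_le_quad], [ln_ge_quad], [entropy_lower_bound]
    and [cbrt_sqr_lower_bound]; the four terms are estimated in
    [interface_lower_bound], [entropy_term_bound], [capillary_term_bound] and
    [kinetic_term_bound].

    The analytic facts needed are the volume [4 pi / 3 r^3] of the ball
    ([leb3_eball], by slicing), from which the dilation formula for integrals
    of radial functions follows ([intB_scale]); that an essential bound on a
    continuous radial function is a pointwise one ([LinftyB_le_pointwise]); and
    differentiation under the integral sign ([is_derive_intB1]). *)

(** * Quadratic lower bounds for elementary functions *)

Section RealInequalities.
Context {R : realType}.
Implicit Types x y z : R.

(** The difference of the two sides vanishes at 0 and its derivative
    [x (1 - 4 x) / (5 (1 + x))] has the sign of [x] up to [x = 1/4].  The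
    constant 2/5, below the optimal 1/2 of the Taylor expansion, makes the
    bound true on a whole neighbourhood of 0. *)
Lemma ln1D_le_quad x : -1 < x <= 1 / 4 -> ln (1 + x) <= x - 2 / 5 * x ^+ 2.
Proof.
move=> /andP[xN1 x14].
pose f (y : R) := y - 2 / 5 * y ^+ 2 - ln (1 + y).
pose f' (y : R) := y * (1 - 4 * y) / (5 * (1 + y)).
have df (y : R) : -1 < y -> is_derive y 1 f (f' y).
  move=> yN1; have y1 : 0 < 1 + y by lra.
  have dl : is_derive y 1 (fun u : R => ln (1 + u)) (1 + y)^-1.
    have dy : is_derive y 1 (fun u : R => 1 + u) 1.
      by apply: is_derive_eq; rewrite add0r mulr1.
    have := @is_derive1_comp R (@ln R) (fun u : R => 1 + u) y _ _
      (is_derive1_ln y1) dy.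
    by rewrite mulr1.
  apply: is_derive_eq; rewrite /GRing.scale /= /f'; field.
  by rewrite lt0r_neq0.
have f0 : f 0 = 0 by rewrite /f addr0 ln1 expr0n /=; ring.
have cf u v : -1 < u -> {within `[u, v], continuous f}.
  move=> uN1; apply: derivable_within_continuous => y.
  rewrite in_itv /= => /andP[uy _].
  by have [] := df y (lt_le_trans uN1 uy).
suff : 0 <= f x by rewrite /f; lra.
have [x0|x0|->] := ltgtP x 0; last by rewrite f0.
- have dx (y : R) : y \in `]x, 0[ -> is_derive y 1 f (f' y).
    by rewrite in_itv /= => /andP[xy _]; apply: df; lra.
  have [y yx E] := MVT x0 dx (cf x 0 xN1).
  move: E; rewrite f0 sub0r => /eqP; rewrite eqr_oppLR => /eqP ->.
  move: yx; rewrite in_itv /= => /andP[xy y0].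
  rewrite sub0r mulrN opprK /f'.
  have -> : y * (1 - 4 * y) / (5 * (1 + y)) * x = (y * x) * ((1 - 4 * y) / (5 * (1 + y))) by ring.
  rewrite mulr_ge0 //; first nra.
  by rewrite divr_ge0 //; lra.
- have N10 : -1 < 0 :> R by lra.
  have dx (y : R) : y \in `]0, x[ -> is_derive y 1 f (f' y).
    by rewrite in_itv /= => /andP[xy _]; apply: df; lra.
  have [y yx E] := MVT x0 dx (cf 0 x N10).
  move: E; rewrite f0 !subr0 => ->.
  move: yx; rewrite in_itv /= => /andP[xy y0].
  by rewrite mulr_ge0 ?(ltW x0) // /f' divr_ge0 // ?mulr_ge0 //; lra.
Qed.

(** The upper bound [ln1D_le_quad] applied to [ln (1 / x) = - ln x]. *)
Lemma ln_ge_quad x : 4 / 5 <= x -> 1 - x^-1 + 2 / 5 * (1 - x^-1) ^+ 2 <= ln x.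
Proof.
move=> x45; have x0 : 0 < x by lra.
have := @ln1D_le_quad (x^-1 - 1).
have -> : 1 + (x^-1 - 1) = x^-1 by ring.
rewrite lnV ?posrE // => H.
have : -1 < x^-1 - 1 <= 1 / 4.
  have xV : 0 < x^-1 by rewrite invr_gt0.
  have xx : x * x^-1 = 1 by rewrite divff // lt0r_neq0.
  apply/andP; split; first lra.
  nra.
by move=> /H; nra.
Qed.

(** Convexity of [u ln u] around [P], with the tangent line written so that its
    second summand has zero mean when [P] is the mean of [u]; 3/8 stands for
    the Taylor coefficient 1/2. *)
Lemma entropy_lower_bound (u P : R) : 0 < P -> `|u - P| <= 1 / 20 * P ->
  u * ln P + (u - P) + 3 / 8 * (u - P) ^+ 2 / P <= u * ln u.
Proof.
move=> P0; rewrite ler_norml => /andP[uP1 uP2].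
have u0 : 0 < u by nra.
have uPE : ln u = ln P + ln (u / P).
  by rewrite -lnM ?posrE ?divr_gt0 // mulrC divfK // lt0r_neq0.
rewrite uPE mulrDr -addrA lerD2l.
have H : 4 / 5 <= u / P by rewrite ler_pdivlMr //; nra.
have := ln_ge_quad _ H => {}H.
have {}H := ler_wpM2l (ltW u0) H.
apply: le_trans H; rewrite invf_div.
have -> : u * (1 - P / u + 2 / 5 * (1 - P / u) ^+ 2) =
  (u - P) + 2 / 5 * (u - P) ^+ 2 / u by field; rewrite lt0r_neq0.
rewrite lerD2l -subr_ge0.
have -> : 2 / 5 * (u - P) ^+ 2 / u - 3 / 8 * (u - P) ^+ 2 / P =
  (u - P) ^+ 2 * ((2 / 5 * P - 3 / 8 * u) / (u * P)).
  by field; rewrite !lt0r_neq0.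
by rewrite mulr_ge0 ?sqr_ge0 // divr_ge0 ?mulr_ge0 ?(ltW u0) ?(ltW P0) //; lra.
Qed.

(** Second-order expansion of [(1 + x)^(2/3)], with 1/8 in place of the exact
    coefficient 1/9; in the variable [z] it is a polynomial inequality with
    double root at 1. *)
Lemma cbrt_sqr_lower_bound z x : 19 / 20 <= z -> z ^+ 3 = 1 + x ->
  1 + 2 / 3 * x - x ^+ 2 / 8 <= z ^+ 2.
Proof.
move=> z1 zx; have {zx} -> : x = z ^+ 3 - 1 by rewrite zx; ring.
rewrite -subr_ge0.
have -> : z ^+ 2 - (1 + 2 / 3 * (z ^+ 3 - 1) - (z ^+ 3 - 1) ^+ 2 / 8) =
  (z - 1) ^+ 2 * ((z ^+ 2 + z + 1) ^+ 2 / 8 - (2 * z + 1) / 3) by field.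
rewrite mulr_ge0 ?sqr_ge0 //.
have : 9 / 10 <= z ^+ 2 by nra.
nra.
Qed.

(** One inequality for both surfaces.  Here [w = (1 + m)^-1 - 1] is the relative
    change of the gas volume and [q] the ratio of the gas volume to the volume
    inside the surface: [q = 1] for the inner one, [q = (Rd / Ad)^3] for the
    outer one, so [z] is the ratio of the corresponding radius to its equilibrium
    value.  The parts linear in [w] cancel, and [2/3 * 2/5 - q / 8] exceeds
    [(1 - q / 3) / 6] for every [q] in [0, 1]. *)
Lemma surface_lower_bound (m q z : R) : 0 < q <= 1 -> `|m| <= 1 / 100 -> 19 / 20 <= z ->
  z ^+ 3 = 1 + q * ((1 + m)^-1 - 1) ->
  m ^+ 2 / 6 * (1 - q / 3) <= 2 / 3 * ln (1 + m) + (z ^+ 2 - 1) / q.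
Proof.
move=> /andP[q0 q1]; rewrite ler_norml => /andP[m1 m2] z1 zE.
have h0 := cbrt_sqr_lower_bound _ _ z1 zE.
have h1 : 4 / 5 <= 1 + m by lra.
have := ln_ge_quad _ h1; set w := (1 + m)^-1 - 1 in zE h0 *.
have -> : 1 - (1 + m)^-1 = - w by rewrite /w; ring.
rewrite sqrrN => h2.
have mE : m = - w * (1 + m) by rewrite /w; field; rewrite lt0r_neq0 //; lra.
have h3 : 2 / 3 * w - q * w ^+ 2 / 8 <= (z ^+ 2 - 1) / q.
  rewrite ler_pdivlMr //; apply: le_trans (_ : 1 + 2 / 3 * (q * w) - (q * w) ^+ 2 / 8 - 1 <= _).
    by rewrite le_eqVlt; apply/orP; left; apply/eqP; field.
  lra.
have h4 : m ^+ 2 <= 11 / 10 * w ^+ 2.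
  rewrite [in X in X <= _]mE exprMn sqrrN mulrC ler_wpM2r ?sqr_ge0 //; nra.
have w2 : 0 <= w ^+ 2 by exact: sqr_ge0.
have h5 : m ^+ 2 / 6 * (1 - q / 3) <= 11 / 60 * w ^+ 2 * (1 - q / 3).
  by apply: ler_wpM2r; lra.
have h6 : q * w ^+ 2 <= w ^+ 2 by nra.
nra.
Qed.

(** [1 - a / A = v / (A (A^2 + A a + a^2))] where [v = A^3 - a^3] is the same
    liquid volume on both sides, so the two expressions are compared through
    their denominators, which differ at most by the factor [1.01^3]. *)
Lemma kinetic_lower_bound (a A r s v : R) : 0 < a -> 0 < A -> 0 < r -> 0 < s -> 0 < v ->
  A ^+ 3 = a ^+ 3 + v -> s ^+ 3 = r ^+ 3 + v ->
  99 / 100 * r <= a -> a <= 101 / 100 * r ->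
  1 - r / s <= 2 * (a / r) ^+ 11 * (1 - a / A).
Proof.
move=> a0 A0 r0 s0 v0 AE sE ra ar.
have As : A <= 101 / 100 * s.
  have c0 : 0 <= 101 / 100 * s by lra.
  rewrite -(@ler_pXn2r _ 3) ?nnegrE ?(ltW A0) // AE exprMn sE mulrDr -exprMn.
  apply: lerD; last lra.
  by rewrite ler_pXn2r ?nnegrE ?(ltW a0) //; lra.
pose D := A * (A ^+ 2 + A * a + a ^+ 2); pose E := s * (s ^+ 2 + s * r + r ^+ 2).
have D0 : 0 < D by rewrite mulr_gt0 // !addr_gt0 ?mulr_gt0 ?exprn_gt0.
have E0 : 0 < E by rewrite mulr_gt0 // !addr_gt0 ?mulr_gt0 ?exprn_gt0.
have h1 : 1 - a / A = v / D.
  have -> : v = (A - a) * (A ^+ 2 + A * a + a ^+ 2).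
    by have -> : v = A ^+ 3 - a ^+ 3 by [rewrite AE; ring]; ring.
  rewrite /D; field; rewrite !lt0r_neq0 // !addr_gt0 ?mulr_gt0 ?exprn_gt0 //.
have h2 : 1 - r / s = v / E.
  have -> : v = (s - r) * (s ^+ 2 + s * r + r ^+ 2).
    by have -> : v = s ^+ 3 - r ^+ 3 by [rewrite sE; ring]; ring.
  rewrite /E; field; rewrite !lt0r_neq0 // !addr_gt0 ?mulr_gt0 ?exprn_gt0 //.
have DE : D <= (101 / 100) ^+ 3 * E.
  have -> : (101 / 100) ^+ 3 * E = (101 / 100 * s) * ((101 / 100 * s) ^+ 2 +
    (101 / 100 * s) * (101 / 100 * r) + (101 / 100 * r) ^+ 2) by rewrite /E; ring.
  by rewrite ler_pM ?lerD ?ler_pXn2r ?ler_pM ?nnegrE ?addr_ge0 ?mulr_ge0 //; lra.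
(* the margin 2 * 7 / 10 exceeds the factor (101 / 100)^3 of DE *)
have p11 : 7 / 10 <= (a / r) ^+ 11.
  apply: (@le_trans _ _ ((99 / 100) ^+ 11)); first last.
    rewrite ler_pXn2r //; first by rewrite ler_pdivlMr.
      by rewrite nnegrE; lra.
    by rewrite nnegrE divr_ge0 // ltW.
  rewrite -[11%N]/(2 + 3 * 3)%N exprD exprM; set c : R := 99 / 100.
  have c3 : 97 / 100 <= c ^+ 3 by rewrite /c; lra.
  have c9 : 91 / 100 <= (c ^+ 3) ^+ 3.
    apply: (@le_trans _ _ ((97 / 100) ^+ 3)); first lra.
    by rewrite ler_pXn2r ?nnegrE //; lra.
  have c2 : 98 / 100 <= c ^+ 2 by rewrite /c; lra.
  nra.
rewrite h1 h2; apply: (@le_trans _ _ (2 * (7 / 10) * (v / D))); last first.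
  rewrite ler_wpM2r ?divr_ge0 ?(ltW v0) ?(ltW D0) //; lra.
rewrite ler_pdivrMr //.
have -> : 2 * (7 / 10) * (v / D) * E = v * ((2 * (7 / 10) * E) / D) by ring.
rewrite -[X in X <= _]mulr1 ler_wpM2l ?(ltW v0) // ler_pdivlMr // mul1r.
apply: (le_trans DE); nra.
Qed.

End RealInequalities.

(** * The volume of Euclidean balls *)

Section Volume.
Context {R : realType}.
Notation leb := (@lebesgue_measure R).
Notation leb2 := (leb \x leb)%E.

Lemma measurable_enorm : measurable_fun setT (@enorm R).
Proof.
apply: (@measurableT_comp _ _ _ _ _ _ (@Num.sqrt R)).
  by apply: continuous_measurable_fun; exact: sqrt_continuous.
apply: measurable_funD.
  apply: measurable_funD; apply: measurable_funX.
    exact: measurableT_comp measurable_fst measurable_fst.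
  exact: measurableT_comp measurable_snd measurable_fst.
by apply: measurable_funX; exact: measurable_snd.
Qed.

Lemma measurable_eball (a : R) : measurable (eball a).
Proof.
have -> : eball a = (@enorm R) @^-1` `]-oo, a[.
  by apply/seteqP; split => x /=; rewrite in_itv.
rewrite -[X in measurable X]setTI.
by apply: measurable_enorm.
Qed.

Lemma enorm_ge0 (x : R * R * R) : 0 <= enorm x.
Proof. exact: sqrtr_ge0. Qed.

Lemma enorm_ltE (x : R * R * R) (a : R) : 0 <= a ->
  (enorm x < a) = (x.1.1 ^+ 2 + x.1.2 ^+ 2 + x.2 ^+ 2 < a ^+ 2).
Proof.
move=> a0; rewrite /enorm -[in RHS](@sqr_sqrtr _ (_ + _ + _)); last first.
  by rewrite !addr_ge0 // sqr_ge0.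
by rewrite ltr_sqr // nnegrE sqrtr_ge0.
Qed.

(** Substitution [x = r sin theta]. *)
Lemma integral_half_circle (r : R) : 0 < r ->
  (\int[leb]_(x in `[(- r)%R, r]) (2 * Num.sqrt (r ^+ 2 - x ^+ 2))%R%:E
   = (pi * r ^+ 2)%R%:E)%E.
Proof.
move=> r0.
pose F (x : R) := r * sin x.
have pi2 : - (pi / 2) < pi / 2 :> R by have := @pi_gt0 R; lra.
have F1 : F (- (pi / 2)) = - r by rewrite /F sinN sin_pihalf; ring.
have F2 : F (pi / 2) = r by rewrite /F sin_pihalf; ring.
have dF (x : R) : is_derive x 1 F (r * cos x).
  by apply: is_derive_eq; rewrite /GRing.scale /=; ring.
have F'E : derive1 F = fun x => r * cos x.
  by apply/funext => x; rewrite derive1E; apply: derive_val.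
have cF' : continuous (fun x : R => r * cos x).
  by move=> x; apply: cvgM; [exact: cvg_cst|exact: continuous_cos].
have cF : continuous F.
  by move=> x; apply: cvgM; [exact: cvg_cst|exact: continuous_sin].
have key (x : R) : - (pi / 2) <= x <= pi / 2 ->
    2 * Num.sqrt (r ^+ 2 - F x ^+ 2) * (r * cos x) = 2 * r ^+ 2 * cos x ^+ 2.
  move=> xpi; rewrite /F.
  have -> : r ^+ 2 - (r * sin x) ^+ 2 = (r * cos x) ^+ 2.
    by rewrite -[X in X - _]mulr1 -(cos2Dsin2 x); ring.
  rewrite sqrtr_sqr ger0_norm; first ring.
  by rewrite mulr_ge0 // ?(ltW r0) // cos_ge0_pihalf.
have -> : (`[- r, r] = `[F (- (pi / 2)), F (pi / 2)])%classic by rewrite F1 F2.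
rewrite integration_by_substitution_increasing //=.
- transitivity (\int[leb]_(x in `[(- (pi / 2))%R, (pi / 2)%R])
      (2 * r ^+ 2 * cos x ^+ 2)%R%:E)%E.
    apply: eq_integral => x; rewrite inE /= in_itv /= => xpi.
    congr (_%:E); rewrite fctE /= F'E; exact: key.
  pose K (x : R) := r ^+ 2 * (x + sin x * cos x).
  have dK (x : R) : is_derive x 1 K (2 * r ^+ 2 * cos x ^+ 2).
    apply: is_derive_eq; rewrite /GRing.scale /=.
    have -> : cos x ^+ 2 = 1 - sin x ^+ 2 by rewrite -(cos2Dsin2 x); ring.
    have := cos2Dsin2 x; nra.
  have cK : continuous K.
    by move=> x; apply: differentiable_continuous; apply/derivable1_diffP; case: (dK x).
  rewrite (@continuous_FTC2 _ _ K) //=.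
  + by rewrite -EFinB /K sinN cosN cos_pihalf; congr (_%:E); field.
  + apply: continuous_subspaceT => x; apply: cvgM; first exact: cvg_cst.
    by apply: cvgM; exact: continuous_cos.
  + split.
    * by move=> x _; case: (dK x).
    * by apply: cvg_at_right_filter; exact: cK.
    * by apply: cvg_at_left_filter; exact: cK.
  + by move=> x _; rewrite derive1E; apply: derive_val.
- by rewrite ltW.
- move=> x y xi yi xy; rewrite /F ltr_pM2l //.
  by rewrite ltr_sin.
- by rewrite F'E => x _; exact: cF'.
- rewrite F'E; apply/cvg_ex; eexists; apply: cvg_at_right_filter; exact: cF'.
- rewrite F'E; apply/cvg_ex; eexists; apply: cvg_at_left_filter; exact: cF'.
- split.
  + by move=> x _; case: (dF x).
  + by apply: cvg_at_right_filter; exact: cF.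
  + by apply: cvg_at_left_filter; exact: cF.
- apply: continuous_subspaceT => x.
  apply: cvgM; first exact: cvg_cst.
  apply: continuous_comp; last exact: sqrt_continuous.
  apply: cvgB; first exact: cvg_cst.
  exact: exprn_continuous.
Qed.

Lemma lt_sqr_sqrt (x c : R) : (x ^+ 2 < c) = (- Num.sqrt c < x < Num.sqrt c).
Proof.
rewrite -ltr_norml; have [c0|c0] := leP c 0.
  rewrite ler0_sqrtr // ltNge (le_trans c0) ?sqr_ge0 //.
  by rewrite ltNge normr_ge0.
rewrite -[in LHS](sqr_sqrtr (ltW c0)) -real_normK ?num_real //.
by rewrite ltr_sqr // nnegrE ?sqrtr_ge0.
Qed.

Lemma leb_sqr_lt (c : R) : leb [set x : R | x ^+ 2 < c] = (2 * Num.sqrt c)%:E.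
Proof.
have -> : [set x : R | x ^+ 2 < c] = `]- Num.sqrt c, Num.sqrt c[%classic.
  by apply/seteqP; split => x /=; rewrite in_itv /= lt_sqr_sqrt.
rewrite lebesgue_measure_itv /= lte_fin; case: ifPn => [_|].
  by rewrite -EFinB; congr (_%:E); ring.
rewrite -leNgt => h; congr (_%:E); have := sqrtr_ge0 c; lra.
Qed.

Lemma leb2_disc (c : R) :
  leb2 [set x : R * R | x.1 ^+ 2 + x.2 ^+ 2 < c] = (pi * Num.max 0 c)%:E.
Proof.
have [c0|c0] := leP c 0.
  rewrite mulr0 (_ : [set _ | _] = set0) ?measure0 //.
  apply/seteqP; split => // x /=; rewrite ltNge (le_trans c0) //.
  by rewrite addr_ge0 // sqr_ge0.
have r0 : 0 < Num.sqrt c by rewrite sqrtr_gt0.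
rewrite -[in RHS](sqr_sqrtr (ltW c0)) -integral_half_circle //.
rewrite [RHS]integral_mkcond /=; apply: eq_integral => x _ /=.
rewrite (_ : xsection _ x = [set y : R | y ^+ 2 < c - x ^+ 2]); last first.
  by apply/seteqP; split => y; rewrite /xsection /= inE /= ltrBrDl.
rewrite leb_sqr_lt patchE sqr_sqrtr ?(ltW c0) //; case: ifPn => // xc.
have : c - x ^+ 2 <= 0.
  rewrite subr_le0 leNgt lt_sqr_sqrt.
  apply/negP => /andP[h1 h2]; move: xc; rewrite notin_setE /= in_itv /=.
  by rewrite !ltW.
by move=> h; rewrite ler0_sqrtr // mulr0.
Qed.

Lemma measurable_disc (c : R) :
  measurable [set x : R * R | x.1 ^+ 2 + x.2 ^+ 2 < c].
Proof.
pose q (x : R * R) := x.1 ^+ 2 + x.2 ^+ 2.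
have mq : measurable_fun setT q.
  apply: measurable_funD; apply: measurable_funX.
    exact: measurable_fst.
  exact: measurable_snd.
have -> : [set x : R * R | x.1 ^+ 2 + x.2 ^+ 2 < c] = q @^-1` `]-oo, c[.
  by apply/seteqP; split => x /=; rewrite in_itv.
by rewrite -[X in measurable X]setTI; apply: mq.
Qed.

(** The area measure under its own name, so that it can carry the instance of
    a sigma-finite measure that Fubini's theorem asks for. *)
Definition area := leb2.

HB.instance Definition _ := Measure.on area.

Lemma sigma_finite_area : sigma_finite setT area.
Proof.
exists (fun n => [set x : R * R | x.1 ^+ 2 + x.2 ^+ 2 < n%:R]).
  apply/seteqP; split => // x _.
  exists (Num.bound (x.1 ^+ 2 + x.2 ^+ 2)) => //=.
  by apply: archi_boundP; rewrite addr_ge0 // sqr_ge0.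
move=> n; split; first exact: measurable_disc.
by rewrite /area leb2_disc ltry.
Qed.

HB.instance Definition _ :=
  Measure_isSigmaFinite.Build _ _ _ area sigma_finite_area.

(** Slicing by horizontal planes. *)
Lemma leb3E (A : set (R * R * R)) : measurable A ->
  leb3 A = (\int[leb]_z area (ysection A z))%E.
Proof.
move=> mA.
suff -> : leb3 A = (area \x^ leb)%E A by reflexivity.
apply: (@product_measure_unique _ _ _ _ R area leb) => [B C mB mC|].
  exact: product_measure2E.
exact: mA.
Qed.

Lemma leb3_eball (r : R) : 0 <= r -> leb3 (eball r) = (4 * pi / 3 * r ^+ 3)%:E.
Proof.
rewrite le_eqVlt => /predU1P[<-|r0].
  have -> : eball (0 : R) = set0.
    by apply/seteqP; split => // x; rewrite /eball /= ltNge enorm_ge0.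
  by rewrite expr0n /= mulr0 /leb3 measure0.
rewrite leb3E; last exact: measurable_eball.
pose F (z : R) := pi * (r ^+ 2 * z - z ^+ 3 / 3).
have dF (z : R) : is_derive z 1 F (pi * (r ^+ 2 - z ^+ 2)).
  by apply: is_derive_eq; rewrite /GRing.scale /=; field.
have cF : continuous F.
  by move=> x; apply: differentiable_continuous; apply/derivable1_diffP; case: (dF x).
transitivity (\int[leb]_(z in `[(- r)%R, r]) (pi * (r ^+ 2 - z ^+ 2))%R%:E)%E; last first.
  rewrite (@continuous_FTC2 _ _ F) //=.
  - by rewrite -EFinB /F; congr (_%:E); field.
  - lra.
  - apply: continuous_subspaceT => x; apply: cvgM; first exact: cvg_cst.
    by apply: cvgB; [exact: cvg_cst|exact: exprn_continuous].
  - split.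
    + by move=> x _; case: (dF x).
    + by apply: cvg_at_right_filter; exact: cF.
    + by apply: cvg_at_left_filter; exact: cF.
  - by move=> x _; rewrite derive1E; apply: derive_val.
rewrite [RHS]integral_mkcond /=; apply: eq_integral => z _ /=.
rewrite (_ : ysection _ z =
    [set p : R * R | p.1 ^+ 2 + p.2 ^+ 2 < r ^+ 2 - z ^+ 2]); last first.
  apply/seteqP; split => p; rewrite /ysection /= inE /= ltrBrDr.
    by rewrite /eball /= enorm_ltE // ltW.
  by rewrite /eball /= enorm_ltE // ltW.
rewrite /area leb2_disc patchE; case: ifPn => zr.
  congr (_ * _)%:E; apply/max_idPr; move: zr; rewrite inE /= in_itv /=.
  rewrite subr_ge0; nra.
rewrite (_ : Num.max _ _ = 0) ?mulr0 //; apply/max_idPl.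
rewrite subr_le0; move: zr; rewrite notin_setE /= in_itv /= => zr.
rewrite leNgt; apply/negP => zr2; apply: zr.
have : `|z| <= `|r| by rewrite -ler_sqr ?nnegrE // !real_normK ?num_real // ltW.
by rewrite (ger0_norm (ltW r0)) ler_norml.
Qed.

End Volume.

(** * Integrals of radial functions over balls *)

Section Radial.
Context {R : realType}.
Implicit Types (f g : R -> R) (a c : R).

Lemma leb3_eball_lty a : (leb3 (eball a) < +oo)%E.
Proof.
have [a0|a0] := leP 0 a; first by rewrite leb3_eball // ltry.
rewrite (_ : eball a = set0) ?/leb3 ?measure0 ?ltry //.
apply/seteqP; split => // x; rewrite /eball /= => /lt_trans /(_ a0).
by rewrite ltNge enorm_ge0.
Qed.

Lemma within_continuous_bounded f a : {within `[0, a], continuous f} ->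
  exists2 C, 0 <= C & forall s, 0 <= s <= a -> `|f s| <= C.
Proof.
move=> cf.
have : bounded_set (f @` `[0, a]).
  by apply: compact_bounded; apply: continuous_compact => //; exact: segment_compact.
move=> [M [_ MP]]; exists (`|M| + 1); first by rewrite addr_ge0.
move=> s sa; apply: (MP (`|M| + 1)).
  by rewrite (le_lt_trans (ler_norm _)) // ltrDl.
by exists s.
Qed.

Lemma integrable_radial_measurable f a C : measurable_fun `[0, a] f ->
  (forall s, 0 <= s <= a -> `|f s| <= C) ->
  leb3.-integrable (eball a) (EFin \o (fun x => f (enorm x))).
Proof.
move=> mf fC.
apply: measurable_bounded_integrable.
- exact: measurable_eball.
- exact: leb3_eball_lty.
- apply: (@measurable_comp _ _ _ _ _ _ `[0, a]) => //.
    move=> _ [x + <-]; rewrite /eball /= in_itv /= enorm_ge0 /=; exact: ltW.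
  by apply: measurable_funTS; exact: measurable_enorm.
- exists C; split; first exact: num_real.
  move=> M CM x; rewrite /eball /= => xa; rewrite (le_trans _ (ltW CM)) //.
  by rewrite fC // enorm_ge0 ltW.
Qed.

Lemma integrable_radial f a : {within `[0, a], continuous f} ->
  leb3.-integrable (eball a) (EFin \o (fun x => f (enorm x))).
Proof.
move=> cf; have [C C0 fC] := within_continuous_bounded f a cf.
apply: (integrable_radial_measurable f a C) => //.
exact: subspace_continuous_measurable_fun.
Qed.

Lemma measurable_scaled_enorm c : measurable_fun setT (fun y => c * @enorm R y).
Proof. by apply: measurable_funM => //; exact: measurable_enorm. Qed.

Lemma leb3_scaled_enorm_lt c b : 0 < c ->
  leb3 ((fun y => c * enorm y) @^-1` `]-oo, b[) =
  (4 * pi / 3 * (Num.max 0 b / c) ^+ 3)%:E.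
Proof.
move=> c0; rewrite (_ : _ @^-1` _ = eball (Num.max 0 b / c)).
  by rewrite leb3_eball // divr_ge0 ?(ltW c0) // le_max lexx.
apply/seteqP; split => x /=; rewrite /eball /= in_itv /= ltr_pdivlMr // mulrC.
  by rewrite lt_max => ->; rewrite orbT.
rewrite lt_max => /orP[|//].
by rewrite ltNge mulr_ge0 ?enorm_ge0 ?(ltW c0).
Qed.

(** Both sides are integrals of [f] over [s < a], against the image of the volume
    under [enorm] and [a^3] times its image under [a * enorm]; these two
    measures agree on the half-lines, by the volume of balls, hence everywhere. *)
Lemma ge0_intB_scale f a : 0 < a -> measurable_fun setT f ->
  (forall s, 0 <= f s) ->
  (\int[leb3]_(x in eball a) (f (enorm x))%:E =
   (a ^+ 3)%:E * \int[leb3]_(y in eball 1) (f (a * enorm y))%:E)%E.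
Proof.
move=> a0 mf f0.
pose T := measurableTypeR R.
pose N (c : R) (y : T * T * T) : T := c * @enorm R y.
have mN c : measurable_fun setT (N c) by exact: measurable_scaled_enorm.
have mF : measurable_fun setT (EFin \o f) by exact/measurable_EFinP.
have F0 s : (0 <= (EFin \o f) s)%E by rewrite lee_fin.
have mA : measurable `]-oo, a[%classic by [].
have E1 : eball a = N 1 @^-1` `]-oo, a[.
  by apply/seteqP; split => x /=; rewrite /eball /N /= in_itv /= mul1r.
have E2 : eball 1 = N a @^-1` `]-oo, a[.
  apply/seteqP; split => x /=; rewrite /eball /N /= in_itv /=.
    by move=> x1; rewrite -[X in _ < X]mulr1 ltr_pM2l.
  by rewrite -[X in _ < X]mulr1 ltr_pM2l.
have a3 : 0 <= a ^+ 3 by rewrite exprn_ge0 // ltW.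
transitivity (\int[pushforward leb3 (N 1%R)]_(s in `]-oo, a[) (EFin \o f) s)%E.
  rewrite ge0_integral_pushforward //; last exact: measurable_funTS.
    by rewrite -E1; apply: eq_integral => x _ /=; by rewrite /N mul1r.
transitivity ((a ^+ 3)%:E * \int[pushforward leb3 (N a)]_(s in `]-oo, a[) (EFin \o f) s)%E; last first.
  congr (_ * _)%E.
  rewrite ge0_integral_pushforward //; last exact: measurable_funTS.
  by rewrite -E2.
have L c b : 0 < c ->
    leb3 (N c @^-1` `]-oo, b[) = (4 * pi / 3 * (Num.max 0 b / c) ^+ 3)%:E.
  exact: leb3_scaled_enorm_lt.
pose k3 : {nonneg R} := NngNum a3.
rewrite (_ : (a ^+ 3)%:E = (k3%:num)%:E) //.
rewrite -ge0_integral_mscale //; last exact: measurable_funTS.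
apply: eq_measure_integral => A mA' _.
refine (@measure_unique _ R T (@RGenInftyO.G R) (fun n => `]-oo, n%:R[%classic)
  _ _ _ _ _ _ _ _ A mA').
- exact: RGenInftyO.measurableE.
- move=> _ _ [x ->] [y ->]; exists (Num.min x y).
  by apply/seteqP; split => z /=; rewrite !in_itv /= lt_min => /andP.
- by move=> n; exists n%:R.
- apply/seteqP; split => // x _; exists (Num.bound `|x|) => //=.
  by rewrite in_itv /= (le_lt_trans (ler_norm x)) // archi_boundP.
- move=> _ [b ->].
  transitivity (4 * pi / 3 * (Num.max 0 b / 1) ^+ 3)%:E; first exact: L.
  transitivity ((a ^+ 3)%:E * leb3 (N a @^-1` `]-oo, b[))%E; last by [].
  by rewrite L // -EFinM; congr (_%:E); field; rewrite lt0r_neq0.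
- move=> n; apply: (@le_lt_trans _ _ (leb3 (N 1 @^-1` `]-oo, n%:R[))) => //.
  by rewrite L // ltry.
Qed.

End Radial.

Section RadialCalculus.
Context {R : realType}.
Implicit Types (f g : R -> R) (a c : R).

Lemma eq_intB f g a : (forall s, 0 <= s < a -> f s = g s) ->
  intB a (fun x => f (enorm x)) = intB a (fun x => g (enorm x)).
Proof.
move=> fg; apply: eq_Rintegral => x; rewrite inE /eball /= => xa.
by rewrite fg // enorm_ge0.
Qed.

Lemma intB_cst c a : 0 <= a -> intB a (fun _ => c) = c * (4 * pi / 3 * a ^+ 3).
Proof.
move=> a0; rewrite /intB Rintegral_cst; last exact: measurable_eball.
congr (_ * _); transitivity (fine (leb3 (eball a))); first by [].
by rewrite leb3_eball.
Qed.

Lemma intBD f g a : {within `[0, a], continuous f} ->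
  {within `[0, a], continuous g} ->
  intB a (fun x => f (enorm x) + g (enorm x)) =
  intB a (fun x => f (enorm x)) + intB a (fun x => g (enorm x)).
Proof.
move=> cf cg; apply: RintegralD; first exact: measurable_eball.
  exact: integrable_radial.
exact: integrable_radial.
Qed.

Lemma intBZ c f a : {within `[0, a], continuous f} ->
  intB a (fun x => c * f (enorm x)) = c * intB a (fun x => f (enorm x)).
Proof.
move=> cf; apply: RintegralZl; first exact: measurable_eball.
exact: integrable_radial.
Qed.

Lemma le_intB f g a : {within `[0, a], continuous f} ->
  {within `[0, a], continuous g} ->
  (forall s, 0 <= s < a -> f s <= g s) ->
  intB a (fun x => f (enorm x)) <= intB a (fun x => g (enorm x)).
Proof.
move=> cf cg fg; apply: le_Rintegral; first exact: measurable_eball.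
- exact: integrable_radial.
- exact: integrable_radial.
- by move=> x; rewrite /eball /= => xa; rewrite fg // enorm_ge0.
Qed.

(** The epsilon-delta form, convenient for rescaling the variable. *)
Lemma within_continuous_itvP f a :
  {within `[0, a], continuous f} <->
  (forall s, 0 <= s <= a -> forall e, 0 < e -> exists2 d, 0 < d &
     forall u, 0 <= u <= a -> `|u - s| < d -> `|f u - f s| < e).
Proof.
split=> [/subspace_continuousP cf s sa e e0|cf].
  have /cf /cvgrPdist_lt /(_ e e0) : `[0, a]%classic s by rewrite /= in_itv.
  rewrite /prop_near1 /within /= => /nbhs_ballP[d /= d0 H]; exists d => // u ua us.
  rewrite distrC; apply: H; last by rewrite in_itv.
  by rewrite /ball /= distrC.
apply/subspace_continuousP => s /=; rewrite in_itv /= => sa.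
apply/cvgrPdist_lt => e e0; have [d d0 H] := cf s sa e e0.
rewrite /prop_near1 /within /=; apply/nbhs_ballP; exists d => //= u us.
rewrite in_itv /= => ua; rewrite distrC; apply: H => //.
by rewrite distrC.
Qed.

Lemma within_continuous_scale f c b : 0 < c ->
  {within `[0, c * b], continuous f} ->
  {within `[0, b], continuous (fun s => f (c * s))}.
Proof.
move=> c0 /within_continuous_itvP cf; apply/within_continuous_itvP => s sb e e0.
have h u : 0 <= u <= b -> 0 <= c * u <= c * b.
  by move=> /andP[u0 ub]; rewrite mulr_ge0 ?(ltW c0) //= ler_pM2l.
have [d d0 H] := cf _ (h _ sb) e e0; exists (d / c); first by rewrite divr_gt0.
move=> u ub; rewrite ltr_pdivlMr // => us; apply: H; first exact: h.
by rewrite -mulrBr normrM gtr0_norm // mulrC.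
Qed.

(** Reduces to [ge0_intB_scale] by adding a constant that bounds [f]. *)
Lemma intB_scale f a : 0 < a -> {within `[0, a], continuous f} ->
  intB a (fun x => f (enorm x)) = a ^+ 3 * intB 1 (fun y => f (a * enorm y)).
Proof.
move=> a0 cf; have [C C0 fC] := within_continuous_bounded f a cf.
pose h (s : R) : R := f s + C; pose g : R -> R := h \_ `[0, a].
have cfC : {within `[0, a], continuous h}.
  by move=> x; apply: cvgD; [exact: cf|exact: cvg_cst].
have mg : measurable_fun setT g.
  apply: (iffLR (measurable_restrictT _ _)) => //.
  exact: subspace_continuous_measurable_fun.
have gE s : 0 <= s <= a -> g s = f s + C.
  by move=> sa; rewrite /g patchE mem_set // /= in_itv.
have g0 s : 0 <= g s.
  rewrite /g patchE; case: ifPn => //; rewrite inE /= in_itv /= => /fC.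
  by rewrite ler_norml /h => /andP[+ _]; lra.
have E : intB a (fun x => g (enorm x)) = a ^+ 3 * intB 1 (fun y => g (a * enorm y)).
  rewrite /intB /Rintegral ge0_intB_scale // fineM //.
  apply: integrable_fin_num; first exact: measurable_eball.
  apply: (integrable_radial_measurable (fun s => g (a * s)) 1 (C + C)).
    apply: measurable_funTS.
    have ma := @mulrl_measurable R setT a.
    exact (measurableT_comp mg ma).
  move=> s /andP[s0 s1]; rewrite gE ?mulr_ge0 ?(ltW a0) //=; last first.
    by rewrite -[X in _ <= X]mulr1 ler_pM2l.
  rewrite (le_trans (ler_normD _ _)) // lerD ?(ger0_norm C0) //.
  rewrite fC // mulr_ge0 ?(ltW a0) //=.
  by rewrite -[X in _ <= X]mulr1 ler_pM2l.
have Ea : intB a (fun x => g (enorm x)) =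
    intB a (fun x => f (enorm x)) + C * (4 * pi / 3 * a ^+ 3).
  rewrite -intB_cst ?(ltW a0) // -(intBD f (cst C)) //.
    by apply: (eq_intB g (fun s => f s + C)) => s /andP[s0 sa]; rewrite gE // s0 ltW.
  by move=> x; exact: cvg_cst.
have E1 : intB 1 (fun x => g (a * enorm x)) =
    intB 1 (fun x => f (a * enorm x)) + C * (4 * pi / 3).
  have -> : 4 * pi / 3 = 4 * pi / 3 * 1 ^+ 3 :> R by rewrite expr1n mulr1.
  rewrite -intB_cst ?(ltW a0) // -(intBD (fun s => f (a * s)) (cst C)) //.
  - apply: (eq_intB (fun s => g (a * s)) (fun s => f (a * s) + C)) => s /andP[s0 sa].
    rewrite gE // mulr_ge0 ?(ltW a0) //=.
    by rewrite -[X in _ <= X]mulr1 ler_pM2l // ltW.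
  - by apply: within_continuous_scale => //; rewrite mulr1.
  - by move=> x; exact: cvg_cst.
by move: E; rewrite Ea E1; lra.
Qed.

Lemma within_continuous_gt_near f a s d : {within `[0, a], continuous f} ->
  0 <= s <= a -> d < `|f s| ->
  exists2 e, 0 < e & forall u, 0 <= u <= a -> `|u - s| < e -> d < `|f u|.
Proof.
move=> /within_continuous_itvP cf sa ds.
have [e e0 H] := cf s sa (`|f s| - d) ltac:(by rewrite subr_gt0).
exists e => // u ua us; have := H u ua us.
by have := ler_normD (f s - f u) (f u); rewrite subrK distrC; lra.
Qed.

(** If the bound failed at one radius, it would fail on a spherical shell by
    continuity, and shells are not negligible. *)
Lemma LinftyB_le_pointwise f a d : 0 < a -> {within `[0, a], continuous f} ->
  (LinftyB a (fun x => f (enorm x)) <= d%:E)%E ->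
  forall s, 0 <= s <= a -> `|f s| <= d.
Proof.
move=> a0 cf Hd s sa; rewrite leNgt; apply/negP => fs.
have [e e0 He] := within_continuous_gt_near f a s d cf sa fs.
pose p := Num.max 0 (s - e / 2); pose q := Num.min a (s + e / 2).
case/andP: sa => s0 sa.
have p0 : 0 <= p by rewrite le_max lexx.
have pq : p < q.
  rewrite lt_min !gt_max a0 /=; apply/and3P; split; lra.
have q0 : 0 <= q by rewrite (le_trans p0) // ltW.
have : forall u, p <= u -> u < q -> d < `|f u|.
  move=> u; rewrite ge_max lt_min => /andP[u1 u2] /andP[u3 u4].
  by apply: He; [rewrite u1 ltW|rewrite ltr_norml; lra].
move=> {}He; move: Hd; rewrite /LinftyB unlock /=.
have T0 : (0 < leb3 [set: R * R * R])%E.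
  apply: (@lt_le_trans _ _ (leb3 (eball a))).
    rewrite leb3_eball ?(ltW a0) // lte_fin.
    by rewrite !mulr_gt0 ?invr_gt0 ?exprn_gt0 ?pi_gt0.
  by apply: le_measure; rewrite ?inE //; exact: measurable_eball.
rewrite T0 => /ess_supP [N [mN N0 HN]].
have : (leb3 (eball q) <= leb3 (eball p))%E.
  apply: (@le_trans _ _ (leb3 (eball p `|` N))).
    apply: le_measure; rewrite ?inE.
    - exact: measurable_eball.
    - by apply: measurableU => //; exact: measurable_eball.
    move=> x /= xq; have [xp|xp] := ltP (enorm x) p; [by left|right].
    apply: HN => /=; rewrite lee_fin; apply/negP; rewrite -ltNge.
    rewrite patchE mem_set; first exact: He.
    by move: xq; rewrite /eball /= lt_min => /andP[].
  apply: (@le_trans _ _ (leb3 (eball p) + leb3 N)%E); last first.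
    by have -> : leb3 N = 0%E := N0; rewrite adde0.
  exact: (@measureU2 _ _ _ leb3 _ _ (measurable_eball p) mN).
rewrite !leb3_eball // lee_fin ler_pM2l; last first.
  by rewrite !mulr_gt0 ?invr_gt0 ?pi_gt0.
by rewrite leNgt => /negP; apply; rewrite ltrXn2r.
Qed.

End RadialCalculus.

(** * Differentiating the mass constraint *)

Section Leibniz.
Context {R : realType}.

(** The time derivative is continuous, hence bounded on the compact set
    [[0, 1] x [t / 2, 2 t]], and a constant is an integrable dominating function
    on the ball. *)
Lemma is_derive_intB1 (rb : R -> R -> R) (t : R) : 0 < t ->
  (forall t, 0 < t -> {within `[0, 1], continuous (rb ^~ t)}) ->
  (forall s t, 0 <= s <= 1 -> 0 < t -> derivable (rb s) t 1) ->
  {within [set z : R * R | 0 <= z.1 <= 1 /\ 0 < z.2],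
    continuous (fun z => derive1 (rb z.1) z.2)} ->
  is_derive t 1 (fun u => intB 1 (fun y => rb (enorm y) u))
    (intB 1 (fun y => derive1 (rb (enorm y)) t)).
Proof.
move=> t0 crb drb cdrb.
pose K : set (R * R) := `[0, 1] `*` `[t / 2, t * 2].
have KS : K `<=` [set z : R * R | 0 <= z.1 <= 1 /\ 0 < z.2].
  by move=> z [/=]; rewrite !in_itv /= => ? /andP[? _]; split => //; lra.
have : bounded_set ((fun z : R * R => derive1 (rb z.1) z.2) @` K).
  apply: compact_bounded; apply: continuous_compact.
    exact: continuous_subspaceW KS cdrb.
  by apply: compact_setX; exact: segment_compact.
move=> [C [_ CP]]; pose D := `|C| + 1.
have DP s u : 0 <= s <= 1 -> t / 2 <= u <= t * 2 -> `|derive1 (rb s) u| <= D.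
  move=> s1 ut; apply: (CP D); first by rewrite (le_lt_trans (ler_norm _)) // ltrDl.
  by exists (s, u) => //; split; rewrite /= in_itv.
have tI : `]t / 2, t * 2[%classic t by rewrite /= in_itv /=; lra.
have e1 (y : R * R * R) : eball 1 y -> 0 <= enorm y <= 1.
  by rewrite /eball /= => ?; rewrite enorm_ge0 ltW.
have h1 u : `]t / 2, t * 2[%classic u -> leb3.-integrable (eball 1) (EFin \o (fun y => rb (enorm y) u)).
  rewrite /= in_itv /= => /andP[u1 u2].
  by apply: (integrable_radial (rb ^~ u)); apply: crb; lra.
have h2 u (y : R * R * R) : `]t / 2, t * 2[%classic u -> eball 1 y ->
    derivable (rb (enorm y)) u 1.
  rewrite /= in_itv /= => /andP[u1 u2] y1; apply: drb; first exact: e1.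
  lra.
have h3 : leb3.-integrable (eball 1) (EFin \o (fun _ : R * R * R => D)).
  apply: (integrable_radial (cst D)).
  by move=> x; exact: cvg_cst.
have h4 (_ : R * R * R) : 0 <= D by rewrite addr_ge0.
have h5 u (y : R * R * R) : `]t / 2, t * 2[%classic u -> eball 1 y ->
    `|derive1 (rb (enorm y)) u| <= D.
  rewrite /= in_itv /= => /andP[u1 u2] y1; apply: DP; first exact: e1.
  by rewrite !ltW.
apply: DeriveDef.
  exact: (@derivable_under_integral R _ _ leb3 (fun u y => rb (enorm y) u)
    (eball 1) (measurable_eball 1) t _ _ tI h1 h2 _ h4 h3 h5).
rewrite -derive1E.
exact: (@differentiation_under_integral R _ _ leb3 (fun u y => rb (enorm y) u)
    (eball 1) (measurable_eball 1) t _ _ tI h1 h2 _ h4 h3 h5).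
Qed.

Lemma derive1_mass_balance (a J : R -> R) (M t J' : R) : 0 < t ->
  (forall u, 0 < u -> a u ^+ 3 * J u = M) ->
  derivable a t 1 -> is_derive t 1 J J' ->
  a t ^+ 3 * J' = - (3 * a t ^+ 2 * derive1 a t * J t).
Proof.
move=> t0 aJ da dJ.
have da' : is_derive t 1 a (derive1 a t).
  by apply: DeriveDef => //; rewrite derive1E.
have H : is_derive t 1 (fun u => a u ^+ 3 * J u)
    (a t ^+ 3 * J' + 3 * a t ^+ 2 * derive1 a t * J t).
  by apply: is_derive_eq; rewrite /GRing.scale /=; ring.
have H0 : is_derive t 1 (fun u => a u ^+ 3 * J u) 0.
  apply: (@near_eq_is_derive _ _ _ (cst M)).
  by near=> u; rewrite aJ //; near: u; exact: lt_nbhsr.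
have := @derive_val _ _ _ _ _ _ _ H; rewrite (@derive_val _ _ _ _ _ _ _ H0); lra.
Unshelve. all: by end_near. Qed.

End Leibniz.

(** * The four parts of the excess energy *)

Section InterfaceAndSurfaces.
Context {R : realType}.

Lemma outer_gt0 (V a : R) : 0 < V -> 0 < a -> 0 < outer V a.
Proof.
move=> V0 a0; apply: powR_gt0; rewrite addr_gt0 ?exprn_gt0 //.
by rewrite divr_gt0 ?mulr_gt0 ?pi_gt0.
Qed.

Lemma outer_cube (V a : R) : 0 < V -> 0 < a ->
  outer V a ^+ 3 = a ^+ 3 + 3 * V / (4 * pi).
Proof.
move=> V0 a0; have h : 0 <= a ^+ 3 + 3 * V / (4 * pi).
  by rewrite addr_ge0 ?exprn_ge0 ?(ltW a0) // divr_ge0 ?mulr_ge0 ?pi_ge0 ?(ltW V0).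
by rewrite /outer -powR_mulrn ?powR_ge0 // -powRrM mulVf ?powRr1.
Qed.

(** Positivity of the interface term, normalized by [rhod] as in the final
    estimate: [((r - P) / rhod)^2 = (P / rhod)^2 (r / P - 1)^2], and the factor
    [(P / rhod)^2] costs less than the ratio of 2/5 to 1/4. *)
Lemma interface_lower_bound (r P rhod : R) : 0 < rhod -> 0 < P ->
  `|r - P| <= 1 / 20 * P -> P <= 101 / 100 * rhod ->
  4^-1 * ((r - P) / rhod) ^+ 2 <= r / P - 1 - ln (r / P).
Proof.
move=> rd0 P0; rewrite ler_norml => /andP[r1 r2] Prd.
have := @ln1D_le_quad R (r / P - 1).
have -> : 1 + (r / P - 1) = r / P by ring.
move=> H; have : -1 < r / P - 1 <= 1 / 4.
  rewrite ltrBrDr addNr divr_gt0 //=; last by nra.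
  by rewrite lerBlDr ler_pdivrMr //; nra.
move=> /H {}H; apply: (@le_trans _ _ (2 / 5 * (r / P - 1) ^+ 2)); last lra.
have -> : (r - P) / rhod = (r / P - 1) * (P / rhod) by field; rewrite !lt0r_neq0.
rewrite exprMn mulrCA mulrC ler_wpM2r ?sqr_ge0 //.
have Pr0 : 0 <= P / rhod by rewrite divr_ge0 ?ltW.
have Pr : P / rhod <= 101 / 100 by rewrite ler_pdivrMr.
nra.
Qed.

(** The sum of [surface_lower_bound] for the two surfaces, weighted by their
    tensions.  The coefficients 8/3 of the logarithm are those that the
    pressure balance gives to [G T M]. *)
Lemma capillary_lower_bound (sg so Rd Ad a A m : R) : 0 < sg -> 0 < so ->
  0 < Rd -> 0 < a -> 0 < A -> Rd <= Ad -> `|m| <= 1 / 100 ->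
  a ^+ 3 * (1 + m) = Rd ^+ 3 -> A ^+ 3 - a ^+ 3 = Ad ^+ 3 - Rd ^+ 3 ->
  m ^+ 2 * (4 / 9 * sg * Rd ^+ 2 + 2 / 3 * so * (Rd ^+ 3 / Ad) * (1 - (Rd / Ad) ^+ 3 / 3))
  <= 8 / 3 * (sg * Rd ^+ 2 + so * (Rd ^+ 3 / Ad)) * ln (1 + m)
     + 4 * (sg * (a ^+ 2 - Rd ^+ 2) + so * (A ^+ 2 - Ad ^+ 2)).
Proof.
move=> sg0 so0 Rd0 a0 A0 RA mb aE AE.
have Ad0 : 0 < Ad by exact: lt_le_trans RA.
have /andP[m1 m2] : - (1 / 100) <= m <= 1 / 100 by rewrite -ler_norml.
have m0 : 0 < 1 + m by lra.
have cube (x y : R) : 0 < x -> 0 < y -> y ^+ 3 <= (20 / 19 * x) ^+ 3 -> 19 / 20 <= x / y.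
  move=> x0 y0; rewrite ler_pXn2r ?nnegrE ?(ltW y0) //; last lra.
  by rewrite ler_pdivlMr //; lra.
have a3 : a ^+ 3 = Rd ^+ 3 / (1 + m) by rewrite -aE mulfK // lt0r_neq0.
have V0 : 0 <= Ad ^+ 3 - Rd ^+ 3.
  by rewrite subr_ge0 ler_pXn2r ?nnegrE ?(ltW Rd0) ?(ltW Ad0).
have a30 : 0 < a ^+ 3 by rewrite exprn_gt0.
have A30 : 0 < A ^+ 3 by rewrite exprn_gt0.
have ya : 19 / 20 <= a / Rd by apply: cube => //; rewrite exprMn -aE; nra.
have zA : 19 / 20 <= A / Ad.
  apply: cube => //; rewrite exprMn.
  have -> : Ad ^+ 3 = A ^+ 3 - a ^+ 3 + a ^+ 3 * (1 + m) by rewrite AE aE; ring.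
  nra.
pose q := (Rd / Ad) ^+ 3.
have q0 : 0 < q by rewrite exprn_gt0 ?divr_gt0.
have q1 : q <= 1.
  by rewrite exprn_ile1 ?divr_ge0 ?(ltW Rd0) ?(ltW Ad0) // ler_pdivrMr // mul1r.
have H1 : m ^+ 2 / 6 * (1 - 1 / 3) <= 2 / 3 * ln (1 + m) + ((a / Rd) ^+ 2 - 1) / 1.
  apply: surface_lower_bound => //; first by rewrite ltr01 lexx.
  by rewrite expr_div_n a3; field; rewrite !lt0r_neq0 ?exprn_gt0.
have H2 : m ^+ 2 / 6 * (1 - q / 3) <= 2 / 3 * ln (1 + m) + ((A / Ad) ^+ 2 - 1) / q.
  apply: surface_lower_bound => //; first by rewrite q0.
  have -> : (A / Ad) ^+ 3 = (Ad ^+ 3 - Rd ^+ 3 + a ^+ 3) / Ad ^+ 3.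
    by rewrite -AE subrK expr_div_n.
  by rewrite a3 /q; field; rewrite !lt0r_neq0.
have {}H1 : 4 * sg * Rd ^+ 2 * (m ^+ 2 / 6 * (1 - 1 / 3)) <=
    4 * sg * Rd ^+ 2 * (2 / 3 * ln (1 + m) + ((a / Rd) ^+ 2 - 1) / 1).
  by rewrite ler_wpM2l // !mulr_ge0 ?exprn_ge0 ?(ltW sg0) ?(ltW Rd0).
have {}H2 : 4 * so * (Rd ^+ 3 / Ad) * (m ^+ 2 / 6 * (1 - q / 3)) <=
    4 * so * (Rd ^+ 3 / Ad) * (2 / 3 * ln (1 + m) + ((A / Ad) ^+ 2 - 1) / q).
  by rewrite ler_wpM2l // !mulr_ge0 ?invr_ge0 ?exprn_ge0 ?(ltW so0) ?(ltW Rd0) ?(ltW Ad0).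
have E1 : 4 * sg * Rd ^+ 2 * (2 / 3 * ln (1 + m) + ((a / Rd) ^+ 2 - 1) / 1) =
    8 / 3 * sg * Rd ^+ 2 * ln (1 + m) + 4 * sg * (a ^+ 2 - Rd ^+ 2).
  by field; rewrite lt0r_neq0.
have E2 : 4 * so * (Rd ^+ 3 / Ad) * (2 / 3 * ln (1 + m) + ((A / Ad) ^+ 2 - 1) / q) =
    8 / 3 * so * (Rd ^+ 3 / Ad) * ln (1 + m) + 4 * so * (A ^+ 2 - Ad ^+ 2).
  by rewrite /q; field; rewrite !lt0r_neq0.
rewrite E1 in H1; rewrite E2 in H2.
rewrite -/q; lra.
Qed.

End InterfaceAndSurfaces.

Section Energy.
Context {R : realType}.

Lemma intB1_quadratic (u : R -> R) (al be ga : R) :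
  {within `[0, 1], continuous u} ->
  intB 1 (fun y => al * u (enorm y) ^+ 2 + be * u (enorm y) + ga) =
  al * intB 1 (fun y => u (enorm y) ^+ 2) + be * intB 1 (fun y => u (enorm y))
  + ga * (4 * pi / 3).
Proof.
move=> cu.
have cu2 : {within `[0, 1], continuous (fun s => u s ^+ 2)}.
  by move=> x; apply: cvgM; exact: cu.
have cc (c : R) : {within `[0, 1], continuous (fun _ : R => c)}.
  by move=> x; exact: cvg_cst.
have cau2 : {within `[0, 1], continuous (fun s => al * u s ^+ 2)}.
  by move=> x; apply: cvgM; [exact: cc|exact: cu2].
have cbu : {within `[0, 1], continuous (fun s => be * u s)}.
  by move=> x; apply: cvgM; [exact: cc|exact: cu].
have cs : {within `[0, 1], continuous (fun s => al * u s ^+ 2 + be * u s)}.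
  by move=> x; apply: cvgD; [exact: cau2|exact: cbu].
rewrite (intBD _ (fun _ => ga) 1 cs (cc ga)) (intBD _ _ 1 cau2 cbu).
by rewrite (intBZ al _ 1 cu2) (intBZ be _ 1 cu) intB_cst // expr1n mulr1.
Qed.

Lemma intB1_sqr_sub (u : R -> R) (c : R) : {within `[0, 1], continuous u} ->
  intB 1 (fun y => (u (enorm y) - c) ^+ 2) =
  intB 1 (fun y => u (enorm y) ^+ 2) - 2 * c * intB 1 (fun y => u (enorm y))
  + c ^+ 2 * (4 * pi / 3).
Proof.
move=> cu; transitivity (intB 1 (fun y =>
    1 * u (enorm y) ^+ 2 + (- (2 * c)) * u (enorm y) + c ^+ 2)).
  apply: (eq_intB (fun s => (u s - c) ^+ 2)
    (fun s => 1 * u s ^+ 2 + (- (2 * c)) * u s + c ^+ 2)) => s _; ring.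
by rewrite intB1_quadratic //; ring.
Qed.

(** Jensen's inequality with a quadratic remainder: integrate
    [entropy_lower_bound] at the mean [P]. *)
Lemma intB1_entropy (u : R -> R) (P : R) : 0 < P ->
  {within `[0, 1], continuous u} ->
  (forall s, 0 <= s <= 1 -> `|u s - P| <= 1 / 20 * P) ->
  intB 1 (fun y => u (enorm y)) = 4 * pi / 3 * P ->
  4 * pi / 3 * P * ln P + 3 / 8 / P * intB 1 (fun y => (u (enorm y) - P) ^+ 2)
  <= intB 1 (fun y => u (enorm y) * ln (u (enorm y))).
Proof.
move=> P0 cu uP JE.
pose g (v : R) := 3 / 8 / P * v ^+ 2 + (ln P + 1 / 4) * v + (- (5 / 8) * P).
have gE v : v * ln P + (v - P) + 3 / 8 * (v - P) ^+ 2 / P = g v.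
  by rewrite /g; field; rewrite lt0r_neq0.
have u0 s : 0 <= s <= 1 -> 0 < u s.
  by move=> /uP; rewrite ler_norml => /andP[]; lra.
have cg : {within `[0, 1], continuous (fun s => g (u s))}.
  apply: within_continuous_comp => // v _.
  apply: cvgD; last exact: cvg_cst.
  apply: cvgD; apply: cvgM; try exact: cvg_cst; last exact: cvg_id.
  exact: exprn_continuous.
have cl : {within `[0, 1], continuous (fun s => u s * ln (u s))}.
  apply: (within_continuous_comp _ u (fun v => v * ln v)) => // v.
  rewrite inE => -[s /=]; rewrite in_itv /= => s1 <-.
  apply: cvgM; first exact: cvg_id.
  by apply: continuous_ln; exact: u0.
apply: (@le_trans _ _ (intB 1 (fun y => g (u (enorm y))))); last first.
  apply: (le_intB (fun s => g (u s)) (fun s => u s * ln (u s))) => // s /andP[s0 s1].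
  by rewrite -gE; apply: entropy_lower_bound => //; apply: uP; rewrite s0 ltW.
rewrite /g intB1_quadratic // intB1_sqr_sub // JE le_eqVlt; apply/orP; left.
by apply/eqP; field; rewrite lt0r_neq0.
Qed.

(** The exact splitting of the excess energy.  The state is described here by the
    values that enter the energy: [r] the density at the interface, [H] the
    integral of [u ln u], [a'] the wall speed and [lRT] the additive constant
    [ln (G T)], which cancels.  Writing [ln r] and [ln P] relative to [P] and to
    [rd], the two masses make all terms in [ln rd] and [ln P] disappear except
    [G T M ln (P / rd)]. *)
Lemma energy_excess (c G T M rd Rd Ad P r a A a' rl sg so H lRT : R) :
  0 < c -> 0 < rd -> 0 < P -> 0 < r ->
  M = 4 * pi / 3 * rd * Rd ^+ 3 -> M = 4 * pi / 3 * P * a ^+ 3 ->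
  (4 * pi * c * T / 3 * r * a ^+ 3 - c * T * M * lRT - c * T * M * ln r
   + c * (1 + G / c) * T * a ^+ 3 * H
   + 2 * pi * rl * a ^+ 3 * a' ^+ 2 - 2 * pi * rl * (a ^+ 4 * a' ^+ 2 / A)
   + 4 * pi * (sg * a ^+ 2 + so * A ^+ 2)) =
  (4 * pi * c * T / 3 * rd * Rd ^+ 3 - c * T * M * lRT - c * T * M * ln rd
   + c * (1 + G / c) * T * Rd ^+ 3 * (rd * ln rd * (4 * pi / 3 * 1 ^+ 3))
   + 2 * pi * rl * Rd ^+ 3 * 0 ^+ 2 - 2 * pi * rl * (Rd ^+ 4 * 0 ^+ 2 / Ad)
   + 4 * pi * (sg * Rd ^+ 2 + so * Ad ^+ 2)) +
  (M * c * T * (r / P - 1 - ln (r / P))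
   + (c + G) * T * a ^+ 3 * (H - 4 * pi / 3 * P * ln P)
   + (G * T * M * ln (P / rd)
      + 4 * pi * (sg * (a ^+ 2 - Rd ^+ 2) + so * (A ^+ 2 - Ad ^+ 2)))
   + 2 * pi * rl * a ^+ 3 * a' ^+ 2 * (1 - a / A)).
Proof.
move=> c0 rd0 P0 r0 M1 M2.
rewrite !ln_div ?posrE //.
have -> : c * (1 + G / c) = c + G by field; rewrite lt0r_neq0.
have -> : 4 * pi * c * T / 3 * r * a ^+ 3 = M * c * T * (r / P).
  by rewrite M2; field; rewrite lt0r_neq0.
have -> : 4 * pi * c * T / 3 * rd * Rd ^+ 3 = M * c * T by rewrite M1; field.
have -> : (c + G) * T * Rd ^+ 3 * (rd * ln rd * (4 * pi / 3 * 1 ^+ 3)) =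
  (c + G) * T * M * ln rd by rewrite M1; field.
have -> : (c + G) * T * a ^+ 3 * (H - 4 * pi / 3 * P * ln P) =
  (c + G) * T * a ^+ 3 * H - (c + G) * T * M * ln P by rewrite M2; field.
ring.
Qed.

End Energy.

Section Terms.
Context {R : realType}.

(** [Q] stands for the integral of [(u - P)^2] and [D] for the entropy excess.
    Since [a^3 = rd Rd^3 / P], the left-hand side and the lower bound for the
    right-hand side are multiples of [Q], and the ratio of the coefficients is
    close to 9/2 even after bounding [c + G] below by [G]. *)
Lemma entropy_term_bound (c G T a3 Rd3 rd P Q D : R) : 0 < c -> 0 < G -> 0 < T ->
  0 < a3 -> 0 < rd -> 0 < P -> P <= 101 / 100 * rd -> 0 <= Q ->
  a3 * P = rd * Rd3 -> 3 / 8 / P * Q <= D ->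
  4^-1 * (G * T * Rd3 / (3 * rd) * Q) <= (c + G) * T * a3 * D.
Proof.
move=> c0 G0 T0 a30 rd0 P0 Prd Q0 mass QD.
have W0 : 0 <= G * T * a3 by rewrite !mulr_ge0 ?ltW.
have D0 : 0 <= D.
  by apply: le_trans QD; rewrite !mulr_ge0 // invr_ge0 ltW.
apply: (@le_trans _ _ (G * T * a3 * D)); last first.
  rewrite ler_wpM2r // ler_wpM2r ?(ltW a30) // ler_wpM2r ?(ltW T0) //; lra.
apply: (@le_trans _ _ (G * T * a3 * (3 / 8 / P * Q))); last by rewrite ler_wpM2l.
have -> : 4^-1 * (G * T * Rd3 / (3 * rd) * Q) =
    G * T * a3 * ((P / rd ^+ 2 / 12) * Q).
  have -> : Rd3 = a3 * P / rd by rewrite mass; field; rewrite lt0r_neq0.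
  by field; rewrite lt0r_neq0.
rewrite ler_wpM2l // ler_wpM2r // -subr_ge0.
have -> : 3 / 8 / P - P / rd ^+ 2 / 12 =
    (9 * rd ^+ 2 - 2 * P ^+ 2) / (24 * P * rd ^+ 2) by field; rewrite !lt0r_neq0.
by rewrite divr_ge0 ?mulr_ge0 ?exprn_ge0 ?(ltW P0) ?(ltW rd0) //; nra.
Qed.

(** The squared term on the left is the integral of the time derivative of the
    density, expressed through the wall speed [a'].  Together with the factor
    [a^3] on the right it leaves the power [(a / Rd)^11] of
    [kinetic_lower_bound]. *)
Lemma kinetic_term_bound (rl rd Rd Ad a A v a' : R) : 0 < rl -> 0 < rd ->
  0 < Rd -> 0 < Ad -> 0 < a -> 0 < A -> 0 < v ->
  A ^+ 3 = a ^+ 3 + v -> Ad ^+ 3 = Rd ^+ 3 + v ->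
  99 / 100 * Rd <= a -> a <= 101 / 100 * Rd ->
  4^-1 * (rl * Rd ^+ 5 / (4 * pi * rd ^+ 2) * (1 - Rd / Ad) *
    (- (4 * pi * rd * Rd ^+ 3 * a' / a ^+ 4)) ^+ 2)
  <= 2 * pi * rl * a ^+ 3 * a' ^+ 2 * (1 - a / A).
Proof.
move=> rl0 rd0 Rd0 Ad0 a0 A0 v0 AE AdE al au.
have K := kinetic_lower_bound a A Rd Ad v a0 A0 Rd0 Ad0 v0 AE AdE al au.
have pi0 := @pi_gt0 R; move: (@pi R) pi0 => p p0.
pose w := p * rl * Rd ^+ 11 / a ^+ 8 * a' ^+ 2.
have w0 : 0 <= w.
  apply: mulr_ge0; last exact: sqr_ge0.
  apply: divr_ge0; last by rewrite exprn_ge0 // ltW.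
  apply: mulr_ge0; last by rewrite exprn_ge0 // ltW.
  by rewrite mulr_ge0 // ltW.
have -> : 4^-1 * (rl * Rd ^+ 5 / (4 * p * rd ^+ 2) * (1 - Rd / Ad) *
    (- (4 * p * rd * Rd ^+ 3 * a' / a ^+ 4)) ^+ 2) = w * (1 - Rd / Ad).
  by rewrite /w; field; rewrite !lt0r_neq0.
apply: le_trans (ler_wpM2l w0 K) _; rewrite le_eqVlt; apply/orP; left.
by apply/eqP; rewrite /w; field; rewrite !lt0r_neq0.
Qed.

(** Of the final estimate this collects the surface term and the part of the
    squared deviation of the density that comes from its mean.  Inside the
    factor 1/4 they add up to exactly [m^2] times the second derivative of the
    capillary energy with respect to the relative gas volume.  The equilibrium
    relation turns [G T rd] into surface tensions, after which the claim is
    [capillary_lower_bound]. *)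
Lemma capillary_term_bound (G T M rd P sg so Rd Ad a A m : R) : 0 < G -> 0 < T ->
  0 < rd -> 0 < sg -> 0 < so ->
  0 < Rd -> 0 < a -> 0 < A -> Rd <= Ad -> `|m| <= 1 / 100 ->
  M = 4 * pi / 3 * rd * Rd ^+ 3 -> rd = 2 / (G * T) * (sg / Rd + so / Ad) ->
  P = rd * (1 + m) ->
  a ^+ 3 * (1 + m) = Rd ^+ 3 -> A ^+ 3 - a ^+ 3 = Ad ^+ 3 - Rd ^+ 3 ->
  4^-1 * (G * T * Rd ^+ 3 / (3 * rd) * (4 * pi / 3 * (P - rd) ^+ 2)
    + Rd ^+ 3 / (pi * rd ^+ 2) *
      (sg / (2 * Rd) + so / Ad * (1 - Rd ^+ 3 / (2 * Ad ^+ 3))) *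
      (4 * pi / 3 * (P - rd)) ^+ 2)
  <= G * T * M * ln (P / rd)
     + 4 * pi * (sg * (a ^+ 2 - Rd ^+ 2) + so * (A ^+ 2 - Ad ^+ 2)).
Proof.
move=> G0 T0 rd0 sg0 so0 Rd0 a0 A0 RA mb ME EQ PE aE AE.
have Ad0 : 0 < Ad by exact: lt_le_trans RA.
have K := capillary_lower_bound sg so Rd Ad a A m sg0 so0 Rd0 a0 A0 RA mb aE AE.
have -> : P / rd = 1 + m by rewrite PE; field; rewrite lt0r_neq0.
have -> : P - rd = rd * m by rewrite PE; ring.
have GTrd : G * T * rd = 2 * (sg / Rd + so / Ad).
  by rewrite EQ; field; rewrite !lt0r_neq0.
have -> : G * T * M = pi * (8 / 3 * (sg * Rd ^+ 2 + so * (Rd ^+ 3 / Ad))).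
  have -> : G * T * M = 4 * pi / 3 * Rd ^+ 3 * (G * T * rd) by rewrite ME; ring.
  by rewrite GTrd; field; rewrite !lt0r_neq0.
have pi0 := @pi_gt0 R; move: (@pi R) pi0 => p p0.
move: (ln (1 + m)) K => L /(ler_wpM2l (ltW p0)) K.
have -> : G * T * Rd ^+ 3 / (3 * rd) * (4 * p / 3 * (rd * m) ^+ 2) =
    (4 / 9) * p * m ^+ 2 * Rd ^+ 3 * (G * T * rd) by field; rewrite lt0r_neq0.
rewrite GTrd; apply: le_trans (_ : _ <= p * (m ^+ 2 * (4 / 9 * sg * Rd ^+ 2 +
  2 / 3 * so * (Rd ^+ 3 / Ad) * (1 - (Rd / Ad) ^+ 3 / 3)))) _.
  rewrite le_eqVlt; apply/orP; left; apply/eqP; field; rewrite !lt0r_neq0 //.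
by apply: (le_trans K); rewrite le_eqVlt; apply/orP; left; apply/eqP; ring.
Qed.

End Terms.

(** * Consequences of the hypotheses on a state *)

Section States.
Context {R : realType}.
Implicit Types (rho : R -> R -> R) (a : R -> R).

Lemma state_continuous rho a t : state rho a -> 0 < t ->
  {within `[0, a t], continuous (rho ^~ t)}.
Proof.
move=> [a_pos _ crho _ _] t0; have a0 := a_pos t t0.
have aV : 0 < (a t)^-1 by rewrite invr_gt0.
have -> : rho ^~ t = fun r => rhobar rho a ((a t)^-1 * r) t.
  by apply/funext => r; rewrite /rhobar mulVKf // lt0r_neq0.
apply: (within_continuous_scale (rhobar rho a ^~ t) (a t)^-1 (a t) aV).
by rewrite mulVf ?lt0r_neq0 //; exact: crho.
Qed.

Lemma mass_rhobar (M : R) rho a t : state rho a -> mass_preserving M rho a ->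
  0 < t -> a t ^+ 3 * intB 1 (fun y => rhobar rho a (enorm y) t) = M.
Proof.
move=> st mass t0; rewrite -(mass t t0).
have [a_pos _ _ _ _] := st.
by rewrite (intB_scale (rho ^~ t) (a t) (a_pos t t0) (state_continuous _ _ _ st t0)).
Qed.

Lemma rhobar_close (d rd : R) rho a t : state rho a -> 0 < t -> 0 < rd ->
  (LinftyB (a t)
     (fun x => ((rho (enorm x) t - rd) / rd * (1 + `|ln rd|))%R) <= d%:E)%E ->
  forall s, 0 <= s <= 1 -> `|rhobar rho a s t - rd| <= d * rd.
Proof.
move=> st t0 rd0 Hd s /andP[s0 s1]; have [a_pos _ _ _ _] := st.
have a0 := a_pos t t0.
pose eta r := (rho r t - rd) / rd * (1 + `|ln rd|).
have ceta : {within `[0, a t], continuous eta}.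
  move=> x; apply: cvgM; last exact: cvg_cst.
  apply: cvgM; last exact: cvg_cst.
  by apply: cvgB; [exact: state_continuous|exact: cvg_cst].
have sa : 0 <= a t * s <= a t.
  by rewrite mulr_ge0 ?(ltW a0) //= -[X in _ <= X]mulr1 ler_pM2l.
have := LinftyB_le_pointwise eta (a t) d a0 ceta Hd (a t * s) sa.
rewrite /eta -/(rhobar rho a s t) !normrM normfV (gtr0_norm rd0).
have l1 : 1 <= `|1 + `|ln rd| | by rewrite ger0_norm ?addr_ge0 // lerDl.
have d0 : 0 <= `|rhobar rho a s t - rd| / rd by rewrite divr_ge0 // ltW.
by move=> /(le_trans (ler_peMr d0 l1)); rewrite ler_pdivrMr.
Qed.

Lemma intB1_close (u : R -> R) (c d : R) : {within `[0, 1], continuous u} ->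
  (forall s, 0 <= s <= 1 -> `|u s - c| <= d) ->
  `|intB 1 (fun y => u (enorm y)) - 4 * pi / 3 * c| <= 4 * pi / 3 * d.
Proof.
move=> cu ucd.
have ccst (b : R) : {within `[0, 1], continuous (fun _ : R => b)}.
  by move=> x; exact: cvg_cst.
have cstE (b : R) : intB 1 (fun _ => b) = 4 * pi / 3 * b.
  by rewrite intB_cst // expr1n mulr1 mulrC.
have bnd s : 0 <= s < 1 -> c - d <= u s /\ u s <= c + d.
  move=> /andP[s0 /ltW s1]; have := ucd s; rewrite s0 s1 => /(_ isT).
  by rewrite ler_norml => /andP[]; split; lra.
rewrite ler_norml lerBrDr lerBlDr -mulrN -!mulrDr -!cstE [d + c]addrC [- d + c]addrC.
apply/andP; split.
  by apply: (le_intB (fun _ => c - d) u) => // s /bnd[].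
by apply: (le_intB u (fun _ => c + d)) => // s /bnd[].
Qed.

(** Differentiating [mass_rhobar] in time slaves the mean of the time derivative
    of the density to the wall speed. *)
Lemma intB1_dt_rhobar (M : R) rho a t : state rho a -> mass_preserving M rho a ->
  0 < t ->
  a t ^+ 3 * intB 1 (fun y => dt_rhobar rho a (enorm y) t) =
  - (3 * a t ^+ 2 * derive1 a t * intB 1 (fun y => rhobar rho a (enorm y) t)).
Proof.
move=> st mass t0; have [_ da crho drho cdt] := st.
have dJ := is_derive_intB1 (rhobar rho a) t t0 crho drho cdt.
have aJ v (v0 : 0 < v) := mass_rhobar M rho a v st mass v0.
exact: derive1_mass_balance t0 aJ (da t t0) dJ.
Qed.

Lemma radius_close (x y m : R) : 0 < x -> 0 < y -> `|m| <= 1 / 100 ->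
  x ^+ 3 * (1 + m) = y ^+ 3 -> 99 / 100 * y <= x <= 101 / 100 * y.
Proof.
move=> x0 y0; rewrite ler_norml => /andP[m1 m2] xy; have x3 := exprn_gt0 3 x0.
have hl : 0 <= 99 / 100 * y by lra.
have hu : 0 <= 101 / 100 * y by lra.
apply/andP; split; rewrite -(@ler_pXn2r _ 3) ?nnegrE ?(ltW x0) // exprMn -xy; nra.
Qed.

End States.

(** * The lower bound for the energy *)

Theorem theorem3p2 (R : realType) (gamma : R) (hgamma : 1 < gamma) :
  exists delta0 : R, 0 < delta0 /\
  forall (k : constants R), gam k = gamma ->
  forall (M V : R), 0 < M -> 0 < V ->
  forall (rhod Rd : R), equilibrium k M V rhod Rd ->
  forall (rho : R -> R -> R) (a : R -> R),
    state rho a -> mass_preserving M rho a ->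
  forall t : R, 0 < t ->
    (LinftyB (a t)
       (fun x => ((rho (enorm x) t - rhod) / rhod * (1 + `|ln rhod|))%R)
       <= delta0%:E)%E ->
    energy k M V (rhobar rho a) a t >=
    energy k M V (fun _ _ => rhod) (fun _ => Rd) t
    + 4^-1 *
      (M * cg k * Tc k *
         ((rhobar rho a 1 t - rhod) / rhod
          - 3 / (4 * pi * rhod)
            * intB 1 (fun y => rhobar rho a (enorm y) t - rhod)) ^+ 2
       + rhol k * Rd ^+ 5 / (4 * pi * rhod ^+ 2) * (1 - Rd / outer V Rd)
         * intB 1 (fun y => dt_rhobar rho a (enorm y) t) ^+ 2
       + Rg k * Tc k * Rd ^+ 3 / (3 * rhod)
         * intB 1 (fun y => `|rhobar rho a (enorm y) t - rhod| ^+ 2)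
       + Rd ^+ 3 / (pi * rhod ^+ 2)
         * (sig k / (2 * Rd)
            + sigo k / outer V Rd * (1 - Rd ^+ 3 / (2 * outer V Rd ^+ 3)))
         * intB 1 (fun y => rhobar rho a (enorm y) t - rhod) ^+ 2).
Proof.
(* One percent: small enough for the margins of all the quadratic bounds. *)
exists (1 / 100); split; first lra.
move=> k _ M V M0 V0 rd Rd [rd0 Rd0 ME EQ] rho a st mass t t0 Linf.
have pi0 := @pi_gt0 R.
have [pi_neq0 rd_neq0] := (lt0r_neq0 pi0, lt0r_neq0 rd0).
have [a_pos _ crho _ _] := st; have a0 := a_pos t t0.
set u := fun s => rhobar rho a s t.
have cu : {within `[0, 1], continuous u} by exact: crho.
have u_close s : 0 <= s <= 1 -> `|u s - rd| <= 1 / 100 * rd.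
  exact: rhobar_close st t0 rd0 Linf s.
pose J := intB 1 (fun y => u (enorm y)).
(* P is the mean density and m its relative deviation from equilibrium. *)
have [P JE] : exists P, J = 4 * pi / 3 * P.
  (* pi is generalized, because field would unfold its definition *)
  by exists (3 / (4 * pi) * J); move: (J) (@pi R) pi_neq0 => j p p0; field.
have [m PE] : exists m, P = rd * (1 + m) by exists (P / rd - 1); field.
have ME2 : M = 4 * pi / 3 * P * a t ^+ 3.
  by rewrite -(mass_rhobar M rho a t st mass t0) -/J JE; ring.
have c43 : 0 < 4 * pi / 3 :> R by rewrite !mulr_gt0 // invr_gt0.
have Pb : `|P - rd| <= 1 / 100 * rd.
  have := intB1_close u rd _ cu u_close.
  by rewrite -/J JE -mulrBr normrM (gtr0_norm c43) ler_pM2l.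
have mb : `|m| <= 1 / 100.
  have -> : m = (P - rd) / rd by rewrite PE; field.
  by rewrite normrM normfV (gtr0_norm rd0) ler_pdivrMr.
have [Pl Pu] : 99 / 100 * rd <= P /\ P <= 101 / 100 * rd.
  by move: Pb; clear -rd0; rewrite ler_norml => /andP[]; split; lra.
have P0 : 0 < P by clear -rd0 Pl; lra.
have uP s : 0 <= s <= 1 -> `|u s - P| <= 1 / 20 * P.
  move=> /u_close; clear -Pl Pu P0; rewrite !ler_norml => /andP[u1 u2].
  by apply/andP; split; lra.
have u11 : 0 <= (1 : R) <= 1 by rewrite ler01 lexx.
have u10 : 0 < u 1.
  by have := uP 1 u11; clear -P0; rewrite ler_norml => /andP[]; lra.
have aRd : a t ^+ 3 * (1 + m) = Rd ^+ 3.
  have c43rd : 4 * pi / 3 * rd != 0 by rewrite mulf_neq0 // lt0r_neq0.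
  by apply: (mulfI c43rd); rewrite ME ME2 PE; ring.
have /andP[al au] := radius_close (a t) Rd m a0 Rd0 mb aRd.
have J'E : intB 1 (fun y => dt_rhobar rho a (enorm y) t) =
    - (4 * pi * rd * Rd ^+ 3 * derive1 a t / a t ^+ 4).
  have a_neq0 := lt0r_neq0 a0.
  apply: (mulfI (expf_neq0 3 a_neq0)).
  rewrite (intB1_dt_rhobar M rho a t st mass t0) -/J JE PE -aRd.
  by move: (a t) (derive1 a t) (@pi R) a_neq0 => b b' p b_neq0; field.
have sgo := sigo_gt0 k; have sg0 := sig_gt0 k; have rl0 := rhol_gt0 k.
have c0 := cg_gt0 k; have G0 := Rg_gt0 k; have T0 := Tc_gt0 k.
have A0 := outer_gt0 V (a t) V0 a0; have Ad0 := outer_gt0 V Rd V0 Rd0.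
have A3 := outer_cube V (a t) V0 a0; have Ad3 := outer_cube V Rd V0 Rd0.
have v0 : 0 < 3 * V / (4 * pi) by rewrite divr_gt0 ?mulr_gt0.
set A := outer V (a t) in A0 A3 *; set Ad := outer V Rd in EQ Ad0 Ad3 *.
set v := 3 * V / (4 * pi) in v0 A3 Ad3.
have RdAd : Rd <= Ad.
  by rewrite -(@ler_pXn2r _ 3) ?nnegrE ?(ltW Rd0) ?(ltW Ad0) // Ad3 lerDl ltW.
have AaE : A ^+ 3 - a t ^+ 3 = Ad ^+ 3 - Rd ^+ 3 by rewrite A3 Ad3; ring.
pose Q := intB 1 (fun y => (u (enorm y) - P) ^+ 2).
have Q0 : 0 <= Q by apply: Rintegral_ge0 => y _; exact: sqr_ge0.
have I1 : intB 1 (fun y => rhobar rho a (enorm y) t - rd) = 4 * pi / 3 * (P - rd).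
  transitivity (intB 1 (fun y => 0 * u (enorm y) ^+ 2 + 1 * u (enorm y) + (- rd))).
    apply: (eq_intB (fun s => u s - rd) (fun s => 0 * u s ^+ 2 + 1 * u s + (- rd))).
    by move=> s _; ring.
  by rewrite intB1_quadratic // -/J JE; ring.
have I2 : intB 1 (fun y => `|rhobar rho a (enorm y) t - rd| ^+ 2) =
    Q + 4 * pi / 3 * (P - rd) ^+ 2.
  transitivity (intB 1 (fun y => (u (enorm y) - rd) ^+ 2)).
    apply: (eq_intB (fun s => `|u s - rd| ^+ 2) (fun s => (u s - rd) ^+ 2)) => s _.
    by rewrite real_normK ?num_real.
  by rewrite /Q !intB1_sqr_sub // -/J JE; ring.
pose H := intB 1 (fun y => u (enorm y) * ln (u (enorm y))).
have entropy : 4 * pi / 3 * P * ln P + 3 / 8 / P * Q <= H.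
  exact: intB1_entropy u P P0 cu uP JE.
rewrite I1 I2 J'E /energy /gam derive1_cst intB_cst //.
rewrite -/A -/Ad -[rhobar rho a 1 t]/(u 1).
have excess := energy_excess (cg k) (Rg k) (Tc k) M rd Rd Ad P (u 1) (a t) A
  (derive1 a t) (rhol k) (sig k) (sigo k) H (ln (Rg k * Tc k)) c0 rd0 P0 u10
  (esym ME) ME2.
refine (@eq_ind_r R _ (fun z => _ <= z) _ _ excess).
rewrite lerD2l; clear excess.
have interface : 4^-1 * (M * cg k * Tc k * ((u 1 - rd) / rd -
    3 / (4 * pi * rd) * (4 * pi / 3 * (P - rd))) ^+ 2) <=
    M * cg k * Tc k * (u 1 / P - 1 - ln (u 1 / P)).
  have -> : (u 1 - rd) / rd - 3 / (4 * pi * rd) * (4 * pi / 3 * (P - rd)) =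
      (u 1 - P) / rd.
    by move: (u 1) (@pi R) pi_neq0 => u1 p p0; field; rewrite ?p0 ?rd_neq0.
  rewrite mulrCA ler_wpM2l //; first by rewrite !mulr_ge0 // ltW.
  by apply: interface_lower_bound => //; exact: uP.
have bulk : 4^-1 * (Rg k * Tc k * Rd ^+ 3 / (3 * rd) * Q) <=
    (cg k + Rg k) * Tc k * a t ^+ 3 * (H - 4 * pi / 3 * P * ln P).
  apply: (entropy_term_bound _ _ _ _ _ _ P) => //.
  - by rewrite exprn_gt0.
  - by rewrite -aRd PE; ring.
  - by rewrite lerBrDl.
have capillary := capillary_term_bound (Rg k) (Tc k) M rd P (sig k) (sigo k)
  Rd Ad (a t) A m G0 T0 rd0 sg0 sgo Rd0 a0 A0 RdAd mb (esym ME) EQ PE aRd AaE.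
have kinetic := kinetic_term_bound (rhol k) rd Rd Ad (a t) A v (derive1 a t)
  rl0 rd0 Rd0 Ad0 a0 A0 v0 A3 Ad3 al au.
apply: le_trans (lerD (lerD (lerD interface bulk) capillary) kinetic).
by rewrite le_eqVlt; apply/orP; left; apply/eqP; ring.
Qed.
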